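(* For any fixed commutative regular language $L$ over a finite alphabet $\Sigma$, there is an algorithm for the out-of-order membership problem for $L$ with $O(1)$ space complexity.
   Context: A language $L$ is commutative if, for every word $w$, letting $n=|w|$, for every permutation $\pi$ of $\{1,\ldots,n\}$, we have $w\in L$ if and only if $w[\pi(1)]\cdots w[\pi(n)]\in L$. Problem. Let $w=w[1]\cdots w[n]$ be a word of length $n>0$ over $\Sigma$ and let $\pi$ be a permutation of $\{1,\ldots,n\}$. The out-of-order stream of $w$ defined by $\pi$ is the sequence of triples $(w[\pi(i)],\pi(i),n)$ for $i=1,\ldots,n$. In the out-of-order membership problem for a fixed language $L\subseteq\Sigma^*$, the algorithm receives the triples one after the other, for arbitrary $w$ and arbitrary $\pi$, and must decide at the end whether $w\in L$. The length $n$ is known and not counted in the space. Space. Algorithms are deterministic, and only the bits memorized between two consecutive stream elements are counted (computation time and interim memory used while processing an element are ignored). Formally, an algorithm using $s(n)$ bits consists, for each $n\ge 1$, of a set $Q_n$ of memory states with $|Q_n|\le 2^{s(n)}$, an initial state, an update function $Q_n\times\Sigma\times\{1,\ldots,n\}\to Q_n$, and an output function $Q_n\to\{\text{yes},\text{no}\}$, such that for every $w\in\Sigma^n$ and every permutation $\pi$ the output after processing the stream is correct. It has $O(g(n))$ space complexity if $s(n)=O(g(n))$. *)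

(* Defs.v *)
From mathcomp Require Import all_boot all_fingroup.

Set Implicit Arguments.
Unset Strict Implicit.
Unset Printing Implicit Defensive.

Definition language (Sigma : finType) : Type := seq Sigma -> Prop.

Record dfa (Sigma : finType) : Type := Dfa {
  dfa_state : finType;
  dfa_start : dfa_state;
  dfa_trans : dfa_state -> Sigma -> dfa_state;
  dfa_final : {set dfa_state}
}.

Definition dfa_accepts (Sigma : finType) (A : dfa Sigma) (w : seq Sigma) : bool :=
  foldl (@dfa_trans Sigma A) (dfa_start A) w \in dfa_final A.

Definition regular (Sigma : finType) (L : language Sigma) : Prop :=
  exists A : dfa Sigma, forall w : seq Sigma, L w <-> dfa_accepts A w.

Definition permute_word (Sigma : finType) (n : nat) (w : n.-tuple Sigma)
    (pi : 'S_n) : n.-tuple Sigma :=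
  [tuple tnth w (pi i) | i < n].

Definition commutative_language (Sigma : finType) (L : language Sigma) : Prop :=
  forall (n : nat) (w : n.-tuple Sigma) (pi : 'S_n),
    L w <-> L (permute_word w pi).

(* Positions are 0-based. The third component of each stream triple is the
   constant length n, which is carried here by the type: both the stream and
   the algorithm processing it are indexed by n. *)
Definition ooo_stream (Sigma : finType) (n : nat) (w : n.-tuple Sigma)
    (pi : 'S_n) : seq (Sigma * 'I_n) :=
  [seq (tnth w (pi i), pi i) | i <- enum 'I_n].

(* The part of an out-of-order algorithm dealing with words of length n. *)
Record ooo_machine (Sigma : finType) (n : nat) : Type := OooMachine {
  mem_state : finType;
  mem_init : mem_state;
  mem_update : mem_state -> Sigma -> 'I_n -> mem_state;
  mem_output : mem_state -> bool
}.

Definition ooo_run (Sigma : finType) (n : nat) (M : ooo_machine Sigma n)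
    (s : seq (Sigma * 'I_n)) : mem_state M :=
  foldl (fun q x => mem_update q x.1 x.2) (mem_init M) s.

(* The machine of index 0 is irrelevant: correctness and space usage are only
   required for n >= 1. *)
Definition ooo_algorithm (Sigma : finType) : Type :=
  forall n : nat, ooo_machine Sigma n.

Definition solves_ooo_membership (Sigma : finType) (A : ooo_algorithm Sigma)
    (L : language Sigma) : Prop :=
  forall n : nat, 0 < n -> forall (w : n.-tuple Sigma) (pi : 'S_n),
    mem_output (ooo_run (A n) (ooo_stream w pi)) <-> L w.

Definition uses_bits (Sigma : finType) (A : ooo_algorithm Sigma)
    (s : nat -> nat) : Prop :=
  forall n : nat, 0 < n -> #|mem_state (A n)| <= 2 ^ s n.

Definition bigO (s g : nat -> nat) : Prop :=
  exists C n0 : nat, forall n : nat, n0 <= n -> s n <= C * g n.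

Definition has_space_complexity (Sigma : finType) (A : ooo_algorithm Sigma)
    (g : nat -> nat) : Prop :=
  exists s : nat -> nat, uses_bits A s /\ bigO s g.

(* Main.v *)
Require Import Defs.
From mathcomp Require Import all_boot all_fingroup.

(* The letters of the stream, read in order of arrival, form a permutation of
   the input word, so by commutativity an automaton for L can be run directly
   on the stream, ignoring the positions. *)

Definition automaton_ooo {Sigma : finType} (D : dfa Sigma) :
    ooo_algorithm Sigma :=
  fun n => @OooMachine Sigma n (dfa_state D) (dfa_start D)
    (fun q a _ => @dfa_trans Sigma D q a) (fun q => q \in dfa_final D).

Lemma ooo_run_automaton (Sigma : finType) (D : dfa Sigma) (n : nat)
    (s : seq (Sigma * 'I_n)) :
  ooo_run (automaton_ooo D n) s =
  foldl (@dfa_trans Sigma D) (dfa_start D) [seq x.1 | x <- s].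
Proof.
rewrite /ooo_run /=.
by elim: s (dfa_start D) => //= x s IHs q; rewrite IHs.
Qed.

(** Both sides unfold to maps over [enum 'I_n], so fusing the two maps on the left makes them
    convertible. This is where arrival order becomes a permuted word, the form that commutativity
    speaks of. *)
Lemma ooo_stream_letters (Sigma : finType) (n : nat) (w : n.-tuple Sigma)
    (pi : 'S_n) :
  [seq x.1 | x <- ooo_stream w pi] = permute_word w pi.
Proof. by rewrite /ooo_stream -map_comp. Qed.

Theorem lemma2p4 (Sigma : finType) (L : language Sigma)
    (Lreg : regular L) (Lcomm : commutative_language L) :
  exists A : ooo_algorithm Sigma,
    solves_ooo_membership A L /\ has_space_complexity A (fun _ : nat => 1).
Proof.
have [D LD] := Lreg; exists (automaton_ooo D); split.
  move=> n _ w pi; rewrite ooo_run_automaton ooo_stream_letters.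
  exact: iff_sym (iff_trans (Lcomm n w pi) (LD _)).
(* The memory is the state set of [D] for every [n]. With [m] states, [m] bits suffice because
   [m < 2 ^ m]; a logarithm would be sharper, but any bound independent of [n] is O(1). *)
exists (fun _ => #|dfa_state D|); split=> [n _ | ].
  by rewrite ltnW // ltn_expl.
by exists #|dfa_state D|, 0 => n _; rewrite muln1.
Qed.
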